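(* Let $f:\Omega\to\mathbb A^{n+1}$ be a non-degenerate graph immersion with constant transversal vector field $\xi$ and with parallel cubic form ($\hat\nabla C=0$), let $y\in\Omega$, let $J$ be the Jordan algebra on $T_y\Omega$ with multiplication $u\bullet v=K(u,v)$, where $K=\nabla-\hat\nabla$ is the difference tensor at $y$, and let $\gamma$ be the bilinear form on $T_y\Omega$ given by the affine fundamental form $h$ at $y$. If $f$ is an improper affine hypersphere with affine normal equal to $\xi$, then $J$ is nilpotent and $\det\gamma=\pm1$.
   Context: A graph immersion $f:\Omega\to\mathbb A^{n+1}$ is a smooth hypersurface immersion of an $n$-dimensional manifold $\Omega$ into real affine space $\mathbb A^{n+1}$, equipped with a constant vector field $\xi$ transversal to $f$. With $D$ the flat connection of $\mathbb A^{n+1}$, the decomposition $D_X f_*Y=f_*(\nabla_XY)+h(X,Y)\xi$ defines the induced (flat, torsion-free) affine connection $\nabla$ and the symmetric affine fundamental form $h$ on $\Omega$. The immersion is non-degenerate if $h$ is non-degenerate; then $\hat\nabla$ denotes the Levi-Civita connection of the pseudo-metric $h$, $C=\nabla h$ is the cubic form, and $K=\nabla-\hat\nabla$ is the difference tensor. ''Parallel cubic form'' means $\hat\nabla C=0$. Under this condition the product $u\bullet v=K(u,v)$ on $T_y\Omega$ is a Jordan algebra product and $\gamma=h_y$ is a non-degenerate trace form on it. Locally $f$ is represented as $x\mapsto(x,F(x))$ with $\xi=(\mathbf 0,1)$ in affine coordinates of $\mathbb A^{n+1}\cong\mathbb R^{n+1}$ in which the fixed parallel volume form is the standard one; $h=F''$.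 The graph immersion is an improper affine hypersphere with affine normal $\xi$ if and only if $\det F''\equiv\pm1$. The determinant of $\gamma$ is taken in such coordinates (i.e. with respect to the volume form $(X_1,\dots,X_n)\mapsto\det(f_*X_1,\dots,f_*X_n,\xi)$). An algebra is nilpotent if there is $m\ge1$ such that every product of $m$ elements (with any bracketing) is zero. *)

(* Defs.v *)
From HB Require Import structures.
From mathcomp Require Import all_boot all_order all_algebra.
From mathcomp Require Import all_classical all_reals all_analysis.

Set Implicit Arguments.
Unset Strict Implicit.
Unset Printing Implicit Defensive.

Import Order.TTheory GRing.Theory Num.Theory.
Import numFieldNormedType.Exports.

Local Open Scope classical_set_scope.
Local Open Scope ring_scope.

Section Smoothness.
Context {R : realType} {V W : normedModType R}.

(* Class C^k on U, meant for open U. *)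
Fixpoint Ck (k : nat) (U : set V) (g : V -> W) : Prop :=
  match k with
  | 0 => forall x, U x -> {for x, continuous g}
  | k'.+1 => (forall x, U x -> differentiable g x) /\
             (forall v, Ck k' U (fun x => 'D_v g x))
  end.

Definition smooth_on (U : set V) (g : V -> W) : Prop := forall k, Ck k U g.

End Smoothness.

Section Manifold.
Variables (R : realType) (n : nat) (M : topologicalType).

(* A homeomorphism [chart_map] from the open set [chart_dom] of M onto the
   open set [chart_cod] of R^n, with inverse [chart_inv]; both maps are junk
   elsewhere. *)
Record chart := Chart {
  chart_dom : set M;
  chart_cod : set 'rV[R]_n;
  chart_map : M -> 'rV[R]_n;
  chart_inv : 'rV[R]_n -> M;
  chart_dom_open : open chart_dom;
  chart_cod_open : open chart_cod;
  chart_map_cod : forall p, chart_dom p -> chart_cod (chart_map p);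
  chart_inv_dom : forall x, chart_cod x -> chart_dom (chart_inv x);
  chart_mapK : forall p, chart_dom p -> chart_inv (chart_map p) = p;
  chart_invK : forall x, chart_cod x -> chart_map (chart_inv x) = x;
  chart_map_cts : forall p, chart_dom p -> {for p, continuous chart_map};
  chart_inv_cts : forall x, chart_cod x -> {for x, continuous chart_inv} }.

Definition overlap (c c' : chart) : set 'rV[R]_n :=
  [set x | chart_cod c x /\ chart_dom c' (chart_inv c x)].

Definition transition (c c' : chart) (x : 'rV[R]_n) : 'rV[R]_n :=
  chart_map c' (chart_inv c x).

(* The smooth structure need not be given by a maximal atlas. *)
Record smooth_manifold (A : set chart) : Prop := SmoothManifold {
  manifold_hausdorff : hausdorff_space M;
  manifold_second_countable : @second_countable M;
  atlas_cover : forall p : M, exists2 c, A c & chart_dom c p;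
  atlas_compatible : forall c c', A c -> A c' ->
    smooth_on (overlap c c') (transition c c') }.

(* In each chart, T_pM is identified with R^n through the coordinates. *)

(* [G c x u v] is the coordinate expression at x, in the chart c, of the
   covariant derivative in the direction u of the vector field with constant
   components v (Christoffel symbols). *)
Definition connection := chart -> 'rV[R]_n -> 'rV[R]_n -> 'rV[R]_n -> 'rV[R]_n.

Definition bilinear_field := chart -> 'rV[R]_n -> 'rV[R]_n -> 'rV[R]_n -> R.

Definition trilinear_field :=
  chart -> 'rV[R]_n -> 'rV[R]_n -> 'rV[R]_n -> 'rV[R]_n -> R.

Definition is_bilinear (W : lmodType R) (b : 'rV[R]_n -> 'rV[R]_n -> W) :
    Prop :=
  (forall (a : R) u u' v, b (a *: u + u') v = a *: b u v + b u' v) /\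
  (forall (a : R) u v v', b u (a *: v + v') = a *: b u v + b u v').

Record affine_connection (A : set chart) (G : connection) : Prop :=
  AffineConnection {
  connection_bilinear : forall c x, A c -> chart_cod c x -> is_bilinear (G c x);
  connection_smooth : forall c u v, A c ->
    smooth_on (chart_cod c) (fun x => G c x u v);
  connection_transition : forall c c' x u v, A c -> A c' -> overlap c c' x ->
    let phi := transition c c' in
    'D_(G c x u v) phi x =
      'D_u (fun z => 'D_v phi z) x + G c' (phi x) ('D_u phi x) ('D_v phi x) }.

Record bilinear_tensor (A : set chart) (h : bilinear_field) : Prop :=
  BilinearTensor {
  tensor_bilinear : forall c x, A c -> chart_cod c x ->
    is_bilinear (h c x : _ -> _ -> R^o);
  tensor_smooth : forall c u v, A c ->
    smooth_on (chart_cod c) (fun x => h c x u v);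
  tensor_transition : forall c c' x u v, A c -> A c' -> overlap c c' x ->
    let phi := transition c c' in
    h c x u v = h c' (phi x) ('D_u phi x) ('D_v phi x) }.

Definition nondegenerate_field (A : set chart) (h : bilinear_field) : Prop :=
  forall c x u, A c -> chart_cod c x -> (forall v, h c x u v = 0) -> u = 0.

Definition torsion_free (A : set chart) (G : connection) : Prop :=
  forall c x u v, A c -> chart_cod c x -> G c x u v = G c x v u.

(* (nabla_w h)(u, v) *)
Definition cov_bilinear (G : connection) (h : bilinear_field) :
    trilinear_field := fun c x w u v =>
  'D_w (fun z => h c z u v) x - h c x (G c x w u) v - h c x u (G c x w v).

(* (nabla_z C)(w, u, v) *)
Definition cov_trilinear (G : connection) (C : trilinear_field)
    (c : chart) (x z w u v : 'rV[R]_n) : R :=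
  'D_z (fun t => C c t w u v) x - C c x (G c x z w) u v
    - C c x w (G c x z u) v - C c x w u (G c x z v).

Record levi_civita (A : set chart) (h : bilinear_field) (G : connection) :
    Prop := LeviCivita {
  levi_civita_connection : affine_connection A G;
  levi_civita_torsion_free : torsion_free A G;
  levi_civita_metric : forall c x w u v, A c -> chart_cod c x ->
    cov_bilinear G h c x w u v = 0 }.

Definition parallel_cubic (A : set chart) (G : connection)
    (C : trilinear_field) : Prop :=
  forall c x z w u v, A c -> chart_cod c x -> cov_trilinear G C c x z w u v = 0.

Definition difference_tensor (G G' : connection) : connection :=
  fun c x u v => G c x u v - G' c x u v.

(* Hypersurface theory in A^{n+1}, identified with R^(n+1) by affine
   coordinates in which the fixed parallel volume form is the determinant. *)

Record immersion (A : set chart) (f : M -> 'rV[R]_(n + 1)) : Prop :=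
  Immersion {
  immersion_smooth : forall c, A c ->
    smooth_on (chart_cod c) (f \o chart_inv c);
  immersion_injective : forall c x u, A c -> chart_cod c x ->
    'D_u (f \o chart_inv c) x = 0 -> u = 0 }.

Definition transversal (A : set chart) (f Xi : M -> 'rV[R]_(n + 1)) : Prop :=
  forall c x u, A c -> chart_cod c x ->
    'D_u (f \o chart_inv c) x <> Xi (chart_inv c x).

Definition graph_immersion (A : set chart) (f : M -> 'rV[R]_(n + 1))
    (xi : 'rV[R]_(n + 1)) : Prop :=
  immersion A f /\ transversal A f (fun=> xi).

(* D_X f_* Y = f_*(nabla_X Y) + h(X, Y) Xi *)
Record induced_structure (A : set chart) (f Xi : M -> 'rV[R]_(n + 1))
    (nabla : connection) (h : bilinear_field) : Prop := InducedStructure {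
  induced_connection : affine_connection A nabla;
  induced_form : bilinear_tensor A h;
  induced_decomposition : forall c x u v, A c -> chart_cod c x ->
    let g := f \o chart_inv c in
    'D_u (fun z => 'D_v g z) x =
      'D_(nabla c x u v) g x + h c x u v *: Xi (chart_inv c x) }.

(* det (f_* X_1, ..., f_* X_n, Xi), the vectors being written as rows *)
Definition induced_volume (f Xi : M -> 'rV[R]_(n + 1)) (c : chart)
    (x : 'rV[R]_n) (X : 'I_n -> 'rV[R]_n) : R :=
  \det (col_mx (\matrix_(i < n) 'D_(X i) (f \o chart_inv c) x)
               (Xi (chart_inv c x))).

Definition gram_matrix (b : 'rV[R]_n -> 'rV[R]_n -> R) (X : 'I_n -> 'rV[R]_n) :
    'M[R]_n := \matrix_(i < n, j < n) b (X i) (X j).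

(* Affine (Blaschke) normal, up to sign: a transversal field that is
   equiaffine (D_u Xi tangent to f) and whose induced volume form agrees, up
   to sign, with the volume form of the affine fundamental form h. *)
Definition affine_normal (A : set chart) (f Xi : M -> 'rV[R]_(n + 1)) : Prop :=
  [/\ forall c, A c -> smooth_on (chart_cod c) (Xi \o chart_inv c),
      transversal A f Xi,
      forall c x u, A c -> chart_cod c x ->
        exists s, 'D_u (Xi \o chart_inv c) x = 'D_s (f \o chart_inv c) x
    & exists nabla h, [/\ induced_structure A f Xi nabla h,
        nondegenerate_field A h
      & forall c x X, A c -> chart_cod c x ->
          `|induced_volume f Xi c x X| =
            Num.sqrt `|\det (gram_matrix (h c x) X)| ] ].

(* Improper affine hypersphere with affine normal Xi: the affine normal is
   parallel, i.e. the affine shape operator vanishes. *)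
Definition improper_affine_hypersphere (A : set chart)
    (f Xi : M -> 'rV[R]_(n + 1)) : Prop :=
  affine_normal A f Xi /\
  forall c x u, A c -> chart_cod c x -> 'D_u (Xi \o chart_inv c) x = 0.

(* d is the determinant of b with respect to the volume form theta, i.e. the
   Gram determinant of b in frames X with theta X = 1 (or -1); the formula is
   the equivalent one for arbitrary frames. *)
Definition is_det_wrt (theta : ('I_n -> 'rV[R]_n) -> R)
    (b : 'rV[R]_n -> 'rV[R]_n -> R) (d : R) : Prop :=
  forall X, \det (gram_matrix b X) = d * theta X ^+ 2.

End Manifold.

Section Nilpotency.
Variables (V : zmodType) (mul : V -> V -> V).

(* The values of all products of m elements, for all bracketings. *)
Inductive product_of : nat -> V -> Prop :=
| product_of1 u : product_of 1 u
| product_ofM a b u v :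
    product_of a u -> product_of b v -> product_of (a + b) (mul u v).

Definition nilpotent_algebra : Prop :=
  exists2 m, (1 <= m)%N & forall u, product_of m u -> u = 0.

End Nilpotency.

(* Main.v *)
(* In a chart, g = f o chart_inv satisfies D_u D_v g = D_(nabla_u v) g + h(u, v) xi,
   and the symmetry of second derivatives gives the symmetry of h and nabla, the
   Codazzi equation and the flatness of nabla.  Hence h(K(u, v), w) is totally
   symmetric and C = -2 h(K(., .), .), so that the parallelism of C is that of
   K.  Then the curvature of the Levi-Civita connection acts as a derivation of
   K, and by flatness it equals -[K_u, K_v]; pairing with h yields the
   linearized Jordan identity.  Since the volume form of h agrees with the
   nabla-parallel one induced by xi, tr K_u = tr nabla_u - tr hatnabla_u = 0.

   If the multiplication operators L_u of a Jordan algebra all have trace zero,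
   they are nilpotent: L_(u^k) is half the k-th power sum of the two commuting
   roots of t^2 = 2 L_u t + (L_(u^2) - 2 L_u^2), so all powers of the companion
   matrix of this equation have trace zero.  An Engel-type induction over
   subalgebras B, adjoining to B one element normalizing B at a time, then makes
   the algebra nilpotent. *)
Require Import Defs.
From HB Require Import structures.
From mathcomp Require Import all_boot all_order all_algebra.
From mathcomp Require Import all_classical all_reals all_analysis.
From mathcomp Require Import perm lra ring.
Import Order.TTheory GRing.Theory Num.Theory.
Import numFieldNormedType.Exports.
Local Open Scope classical_set_scope.
Local Open Scope ring_scope.
Set Implicit Arguments.
Unset Strict Implicit.

(** * Nilpotency of matrices from traces and recurrences *)

Lemma mxtrace_idempotent (F : fieldType) n (E : 'M[F]_n) :
  E *m E = E -> \tr E = (\rank E)%:R.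
Proof.
move=> EE; rewrite -{1}[E]mulmx_base mxtrace_mulC.
(* With E = C R a full-rank factorization, C R C R = C R; cancelling C on the left and R on the
   right leaves R C = 1, of size the rank. *)
suff -> : row_base E *m col_base E = 1%:M by rewrite mxtrace1.
apply: (row_free_inj (row_base_free E)); rewrite mul1mx -mulmxA.
have cf := col_base_full E.
apply/(@row_full_inj _ _ _ _ _ cf).
by rewrite 2!mulmxA mulmx_base -[RHS]EE -mulmxA mulmx_base.
Qed.

(** The Fitting idempotent E of the non-nilpotent part of P is a polynomial in P without constant
    term, so its trace vanishes; in characteristic zero its rank does too. *)
Lemma nilpotent_mxtrace (F : numFieldType) n (P : 'M[F]_n) :
  (forall k, \tr (P ^+ k.+1) = 0) -> exists k, P ^+ k = 0.
Proof.
case: n P => [|n] P trP; first by exists 0%N; apply/matrixP => -[].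
have trPr r k : \tr (horner_mx P r * P ^+ k.+1) = 0.
  elim/poly_ind: r k => [|r c IHr] k; first by rewrite rmorph0 mul0r mxtrace0.
  rewrite rmorphD rmorphM /= horner_mx_X horner_mx_C mulrDl -mulrA -exprS.
  by rewrite mxtraceD IHr -mulmxE mul_scalar_mx mxtraceZ trP mulr0 addr0.
have [m [q q0 defp]] := multiplicity_XsubC (char_poly P) 0.
rewrite monic_neq0 ?char_poly_monic //= in q0.
(* The exponent m + 1 instead of m makes E a multiple of P even when m = 0, as [trPr] requires. *)
have cop : coprimep ('X ^+ m.+1) q.
  by rewrite coprimep_expl // coprimep_sym coprimepX.
have /Bezout_eq1_coprimepP [[u v] /= uv1] := cop.
pose E := horner_mx P (u * 'X ^+ m.+1).
have CH : horner_mx P (q * 'X ^+ m) = 0.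
  by rewrite -[RHS](Cayley_Hamilton P) defp polyC0 subr0.
have E1 : E = 1 - horner_mx P (v * q).
  by rewrite /E -[u * _](addrK (v * q)) uv1 rmorphB rmorph1.
have EE : E *m E = E.
  rewrite mulmxE {2}E1 mulrBr mulr1 /E -rmorphM /=.
  have -> : u * 'X^(m.+1) * (v * q) = (u * 'X * v) * (q * 'X^m).
    by rewrite exprS; ring.
  by rewrite [X in _ - X]rmorphM /= CH mulr0 subr0.
have rk0 : \rank E = 0%N.
  apply/eqP; rewrite -(pnatr_eq0 F) -mxtrace_idempotent //.
  by rewrite /E rmorphM rmorphXn /= horner_mx_X trPr.
have E0 : E = 0 by apply/eqP; rewrite -mxrank_eq0 rk0.
exists m; have : horner_mx P (v * q) = 1 by apply/eqP; rewrite eq_sym -subr_eq0 -E1 E0.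
move=> /(congr1 (fun M => M * P ^+ m)); rewrite mul1r => <-.
have -> : horner_mx P (v * q) * P ^+ m = horner_mx P v * horner_mx P (q * 'X^m).
  by rewrite !rmorphM rmorphXn /= horner_mx_X mulrA.
by rewrite CH mulr0.
Qed.

(* The sums of the alpha^i beta^j, i + j = k, over the roots alpha, beta of
   t^2 = 2 L t + Q. *)
Fixpoint lucas (R : pzRingType) (L Q : R) (k : nat) : R :=
  match k with
  | 0 => 1
  | k'.+1 => match k' with
             | 0 => L *+ 2
             | k''.+1 => L *+ 2 * lucas L Q k' + Q * lucas L Q k''
             end
  end.

Lemma lucasSS (R : pzRingType) (L Q : R) k :
  lucas L Q k.+2 = L *+ 2 * lucas L Q k.+1 + Q * lucas L Q k.
Proof. by []. Qed.

(** Running the recurrence backwards from two consecutive zeros down to the term 1 makes Q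
    nilpotent; modulo Q the m-th term is (2 L)^m, so L is nilpotent as well. *)
Lemma lucas_nilpotent (F : numFieldType) n (L Q : 'M[F]_n) m :
  L * Q = Q * L -> lucas L Q m = 0 -> lucas L Q m.+1 = 0 ->
  exists k, L ^+ k = 0.
Proof.
move=> LQ pm pm1.
have LQe e : Q ^+ e * L = L * Q ^+ e.
  by apply/esym/commrX.
have [e Qe0] : exists e, Q ^+ e = 0.
  have: Q ^+ 0 * lucas L Q m = 0 by rewrite pm mulr0.
  have: Q ^+ 0 * lucas L Q m.+1 = 0 by rewrite pm1 mulr0.
  elim: m {pm pm1} 0%N => [|m IHm] e; first by rewrite mulr1; exists e.
  rewrite lucasSS mulrDr => + pm.
  have -> : Q ^+ e * (L *+ 2 * lucas L Q m.+1) =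
      L *+ 2 * (Q ^+ e * lucas L Q m.+1).
    by rewrite !mulrnAl mulrnAr !mulrA LQe.
  rewrite pm mulr0 add0r mulrA -exprSr => Qpm.
  by apply: (IHm e.+1) => //; rewrite exprS -mulrA pm mulr0.
suff: exists k, Q ^+ 0 * L ^+ k = 0 by case=> k; rewrite mul1r; exists k.
have: exists k, Q ^+ e * L ^+ k = 0 by exists 0%N; rewrite Qe0 mul0r.
elim: e {Qe0} => [//|e IHe] [E QLE]; apply: IHe.
exists (m + E)%N.
(* Q kills X, so multiplying the recurrence by X leaves (2 L)^k X; the vanishing of term m then
   gives L^m X = 0. *)
pose X := Q ^+ e * L ^+ E.
have XL : X * (L *+ 2) = (L *+ 2) * X.
  by rewrite mulrnAr mulrnAl /X -mulrA -exprSr exprS mulrA LQe mulrA.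
have XQ : X * Q = 0.
  rewrite /X -mulrA; have -> : L ^+ E * Q = Q * L ^+ E by apply/esym/commrX/esym.
  by rewrite mulrA -exprSr QLE.
have Xlucas k : X * lucas L Q k = (L *+ 2) ^+ k * X.
  move: (X) XL XQ => Y YL YQ.
  elim/ltn_ind: k => -[_|[_|k IHk]].
  - by rewrite /= mulr1 expr0 mul1r.
  - by rewrite expr1.
  - by rewrite lucasSS mulrDr !mulrA YQ mul0r addr0 YL -mulrA IHk // mulrA -exprS.
have := Xlucas m; rewrite pm mulr0 exprMn_n mulrnAl => /esym/eqP.
rewrite -scaler_nat scaler_eq0 pnatr_eq0 expn_eq0 /= => /eqP <-.
by rewrite /X exprD !mulrA; congr (_ * _); apply: commrX; apply/commr_sym/commrX.
Qed.

(** * Jordan algebras with traceless multiplications *)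

Section NilpotentJordan.
Variables (F : realFieldType) (n : nat).
Variable mul : 'rV[F]_n -> 'rV[F]_n -> 'rV[F]_n.
Local Notation V := 'rV[F]_n.
Local Infix "•" := mul (at level 40, left associativity).

Hypothesis mulC : forall u v, u • v = v • u.
Hypothesis mulP : forall a u v w, u • (a *: v + w) = a *: (u • v) + u • w.
Hypothesis jordan : forall a b c w,
  (a • b) • (c • w) + (b • c) • (a • w) + (c • a) • (b • w) =
  c • ((a • b) • w) + a • ((b • c) • w) + b • ((c • a) • w).

Fact mulr_linear u : linear (mul u).
Proof. by move=> a v w; exact: mulP. Qed.
HB.instance Definition _ u :=
  GRing.isLinear.Build F V V _ (mul u) (@mulr_linear u).

Lemma mul0l v : 0 • v = 0.
Proof. by rewrite mulC linear0. Qed.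

Lemma mulDl u v w : (u + v) • w = u • w + v • w.
Proof. by rewrite !(mulC _ w) linearD. Qed.

Lemma mulZl a v w : (a *: v) • w = a *: (v • w).
Proof. by rewrite !(mulC _ w) linearZ. Qed.

(** The identity for b, c, v applied to a and the one for a, b, c applied to v share their left-hand
    side; the right-hand sides are equated. *)
Lemma L_mulE a b c v :
  (a • (b • c)) • v = a • ((b • c) • v) + b • ((a • c) • v) + c • ((a • b) • v)
    - b • (a • (c • v)) - c • (a • (b • v)).
Proof.
have := jordan b c v a; have := jordan a b c v.
rewrite (mulC (c • v)) (mulC (v • b)) (mulC v ((b • c) • a)) (mulC v a).
rewrite (mulC (b • c) a) (mulC c a) (mulC b a) (mulC v b) (mulC (c • v) a).
rewrite (mulC (b • v) a) => e1 e2; apply/rowP => j.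
by move/rowP/(_ j): e1; move/rowP/(_ j): e2; rewrite !mxE; lra.
Qed.

Lemma L_sq_comm x v : x • ((x • x) • v) = (x • x) • (x • v).
Proof.
have e := jordan x x x v; apply/rowP => j.
by move/rowP/(_ j): e; rewrite !mxE; lra.
Qed.

(** Equivalently, L_(b x^2) - L_(x (x b)) = [L_x, [L_x, L_b]]. The terms in L_(x^2) cancel between
    two instances of [L_mulE], which serves when x normalizes a subalgebra but x^2 may not. *)
Lemma L_mul_sqE b x v :
  (b • (x • x)) • v =
  (x • (x • b)) • v + x • (x • (b • v)) + b • (x • (x • v))
  - x • (b • (x • v)) - x • (b • (x • v)).
Proof.
rewrite L_mulE (L_mulE x x b) (mulC b x).
by apply/rowP => j; rewrite !mxE; lra.
Qed.

Definition subalgebra (B : {vspace V}) := forall a b, a \in B -> b \in B ->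
  a • b \in B.

Definition invariant (B W : {vspace V}) := forall b v, b \in B -> v \in W ->
  b • v \in W.

(* The conclusion of Engel's theorem for the operators [mul b], b in B, acting
   on the subquotients of the algebra. *)
Definition engel (B : {vspace V}) := forall W S : {vspace V},
  invariant B W -> invariant B S -> ~~ (W <= S)%VS ->
  exists v, [/\ v \in W, v \notin S & forall b, b \in B -> b • v \in S].

Local Ltac memv := solve [ assumption | exact: memvf
  | apply: memvD; memv | apply: memvB; memv | apply: memvZ; memv
  | match goal with H : forall _, _ |- _ => solve [apply: H; memv] end
  | match goal with H : subalgebra _ |- _ => solve [apply: H; memv] end
  | match goal with H : invariant _ _ |- _ => solve [apply: H; memv] end ].

(** From a v sent into S by B one passes to y v, y (y v), and so on; as y is nilpotent, the last of
    these outside S is sent into S by y too, unless a suitable vector turns up on the way. *)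
Lemma engel_adjoin B y : subalgebra B -> engel B ->
  (forall b, b \in B -> y • b \in B) -> y • y \in B ->
  (exists k, forall v, iter k (mul y) v = 0) -> engel (B + <[y]>).
Proof.
move=> algB engB yB yyB [k nil_y] W S WB SB nWS.
have subB b : b \in B -> b \in (B + <[y]>)%VS by exact: (subvP (addvSl B _)).
have iny : y \in (B + <[y]>)%VS by rewrite (subvP (addvSr B _)) ?memv_line.
have BW b v : b \in B -> v \in W -> b • v \in W by move=> /subB; exact: WB.
have BS b v : b \in B -> v \in S -> b • v \in S by move=> /subB; exact: SB.
have yW v : v \in W -> y • v \in W by exact: WB.
have yS v : v \in S -> y • v \in S by exact: SB.
pose killed v := [/\ v \in W, v \notin S &
  forall b, b \in (B + <[y]>)%VS -> b • v \in S].
have killedP w : w \in W -> w \notin S -> (forall b, b \in B -> b • w \in S) ->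
    y • w \in S -> killed w.
  move=> wW wS Bw yw; split=> // _ /memv_addP [b bB [_ /vlineP[a ->]]] ->.
  by rewrite mulDl mulZl; memv.
have [v [vW vS Bv]] : exists v, [/\ v \in W, v \notin S &
    forall b, b \in B -> b • v \in S].
  by apply: engB.
(* Either B again sends y u into S, or some b (y u) outside S is already the vector sought. *)
have step u : u \in W -> u \notin S -> (forall b, b \in B -> b • u \in S) ->
    (exists v, killed v) \/ (forall b, b \in B -> b • (y • u) \in S).
  move=> uW uS Bu.
  have [Byu|/existsNP] := pselect (forall b, b \in B -> b • (y • u) \in S).
    by right.
  move=> [b /not_implyP[bB /negP byuS]]; left.
  have By a : a \in B -> a • y \in B by rewrite mulC; exact: yB.
  exists (b • (y • u)); apply: killedP => //; first by rewrite BW ?yW.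
    move=> a aB.
    (* In each term on the right an element of B acts on u first, which lands in S. *)
    have -> : a • (b • (y • u)) = b • ((a • y) • u) + a • ((b • y) • u) +
        y • ((b • a) • u) - (b • (a • y)) • u - y • (b • (a • u)).
      rewrite (L_mulE b a y); apply/rowP => j; rewrite !mxE; lra.
    by memv.
  (* The same expansion with a = y contains the wanted term twice, whence the factor 2^-1. *)
  have -> : y • (b • (y • u)) =
      2^-1 *: (b • ((y • y) • u) + y • ((b • y) • u) + y • ((b • y) • u)
               - (b • (y • y)) • u).
    rewrite (L_mulE b y y); apply/rowP => j; rewrite !mxE; lra.
  by memv.
have: iter k (mul y) v \in S by rewrite nil_y mem0v.
elim: k v vW vS Bv {nil_y} => [|k IHk] v vW vS Bv; first by rewrite (negbTE vS).
rewrite iterSr => yvS; have [yv|yv] := boolP (y • v \in S).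
  by exists v; exact: killedP.
have [//|Byv] := step v vW vS Bv.
by apply: (IHk (y • v)) => //; exact: yW.
Qed.

(* An element normalizing B and with square in B can be adjoined to B. If x
   normalizes B and x^2 is not in B, then either x^2 normalizes B too, or
   x^2 b works for some b in B. *)
Lemma exists_adjoinable B : subalgebra B -> engel B -> B != fullv ->
  (forall x, exists k, iter k (fun z => z • z) x = 0) ->
  exists y, [/\ y \notin B, forall b, b \in B -> y • b \in B & y • y \in B].
Proof.
move=> algB engB nB nil.
(* With W the whole space and S = B, the vector provided is an element outside B that normalizes
   B. *)
have [|||x [_ xB Bx]] := engB fullv B.
- by move=> *; rewrite memvf.
- exact: algB.
- by apply: contraNN nB => le; rewrite eqEsubv le subvf.
have {}Bx b : b \in B -> x • b \in B by rewrite mulC; exact: Bx.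
have [k] := nil x.
elim: k x xB Bx => [|k IHk] x xB Bx.
  by move=> /= x0; rewrite x0 mem0v in xB.
rewrite iterSr => xk0; have [xxB|xxB] := boolP (x • x \in B); first by exists x.
have [Bxx|/existsNP] := pselect (forall b, b \in B -> (x • x) • b \in B).
  exact: (IHk (x • x)).
move=> [b /not_implyP[bB /negP xxbB]].
have Bxxb c d : c \in B -> d \in B -> c • ((x • x) • d) \in B.
  move=> cB dB; rewrite mulC (mulC _ d) L_mul_sqE.
  by memv.
exists ((x • x) • b); split=> //.
  by move=> c cB; rewrite mulC Bxxb.
(* Moving x past x^2 leaves products c (x^2 d) with c, d in B, to which at most x and b are further
   applied. *)
rewrite {1}(mulC _ b) L_mul_sqE !L_sq_comm.
by memv.
Qed.

Lemma engel_full : (forall x, exists k, iter k (fun z => z • z) x = 0) ->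
  (forall x, exists k, forall v, iter k (mul x) v = 0) -> engel fullv.
Proof.
move=> nil nilL.
suff [B [algB engB]] : exists B, [/\ subalgebra B, engel B & (\dim {:V} <= \dim B)%N].
  move=> dimB; suff -> : fullv = B by [].
  by apply/esym/eqP; rewrite eqEdim subvf.
have: (\dim {:V} <= \dim {:V})%N by [].
elim: {1 3}(\dim {:V}) => [|d IHd] ltd.
  exists 0%VS; split=> //.
    by move=> a b /[!memv0] /eqP -> _; rewrite mul0l.
  move=> W S _ _ /subvPn [v vW vS]; exists v; split=> // b.
  by rewrite memv0 => /eqP ->; rewrite mul0l mem0v.
have [B [algB engB dimB]] := IHd (ltnW ltd).
have [|nB] := eqVneq B fullv.
  by move=> BT; exists B; split=> //; rewrite BT.
have [y [yB By yyB]] := exists_adjoinable algB engB nB nil.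
exists (B + <[y]>)%VS; split.
- move=> _ _ /memv_addP[a aB [_ /vlineP[k ->]]] -> /memv_addP[b bB [_ /vlineP[l ->]]] ->.
  apply/(subvP (addvSl _ _)); rewrite linearD linearZ /= !mulDl !mulZl.
  by rewrite (mulC a y); memv.
- exact: engel_adjoin.
- rewrite (leq_ltn_trans dimB) // ltnNge; apply: contraNN yB => le.
  have /eqP -> : B == (B + <[y]>)%VS by rewrite eqEdim addvSl.
  by rewrite (subvP (addvSr B _)) ?memv_line.
Qed.

(** One factor of a product of at least 2^(d+1) elements is a product of at least 2^d; by
    commutativity the other factor becomes an outer multiplication. *)
Lemma product_of_foldr d m u : product_of mul m u -> (2 ^ d <= m)%N ->
  exists s v, size s = d /\ u = foldr mul v s.
Proof.
elim: d m u => [|d IHd] m u; first by exists [::], u.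
case=> [w /(leq_trans (ltn_expl d.+1 (ltnSn 1)))|a b v w Pv Pw] //.
rewrite expnS mul2n -addnn => le.
have [lea|lta] := leqP (2 ^ d) a.
  have [s [z [szs ->]]] := IHd _ _ Pv lea.
  by exists (w :: s), z; rewrite /= szs mulC.
have [|s [z [szs ->]]] := IHd _ _ Pw; last by exists (v :: s), z; rewrite /= szs.
by rewrite -(leq_add2l a) (leq_trans _ le) // leq_add2r ltnW.
Qed.

(** An ideal S killed by d successive multiplications grows by a vector v that all multiplications
    send into S; the larger ideal is killed by d + 1. *)
Lemma engel_nilpotent : engel fullv -> nilpotent_algebra mul.
Proof.
move=> eng.
suff [d kill] : exists d, forall s v, size s = d -> foldr mul v s = 0.
  exists (2 ^ d)%N => [|u Pu]; first by rewrite expn_gt0.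
  by have [s [v [szs ->]]] := product_of_foldr Pu (leqnn _); exact: kill.
suff [S [_ [d kill] /eqP dimS]] : exists S, [/\ invariant fullv S,
    exists d, forall s v, size s = d -> v \in S -> foldr mul v s = 0
  & \dim S == \dim {:V}].
  exists d => s v szs; apply: kill => //.
  suff -> : S = fullv by rewrite memvf.
  by apply/eqP; rewrite eqEdim subvf dimS /=.
suff [S [SV kill dimS]] : exists S, [/\ invariant fullv S,
    exists d, forall s v, size s = d -> v \in S -> foldr mul v s = 0
  & (\dim {:V} <= \dim S)%N].
  by exists S; split=> //; rewrite eqn_leq dimvS ?subvf.
have: (\dim {:V} <= \dim {:V})%N by [].
elim: {1 3}(\dim {:V}) => [|m IHm] ltm.
  exists 0%VS; split=> //.
    by move=> a b _ /[!memv0] /eqP ->; rewrite linear0.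
  by exists 0%N => s v /size0nil -> /[!memv0] /eqP.
have [S [SV [d kill] dimS]] := IHm (ltnW ltm).
have [leS|nS] := boolP (fullv <= S)%VS.
  by exists S; split=> //; [exists d | rewrite (leq_trans ltm) ?dimvS].
have [|v [_ vS Sv]] := eng fullv S _ SV nS; first by move=> *; rewrite memvf.
exists (S + <[v]>)%VS; split.
- move=> b _ _ /memv_addP[w wS [_ /vlineP[k ->]]] ->.
  apply/(subvP (addvSl _ _)); rewrite linearD linearZ /=.
  by memv.
- exists d.+1 => s w; elim/last_ind: s => // s b _; rewrite size_rcons => -[szs].
  move=> /memv_addP[z zS [_ /vlineP[k ->]]] ->; rewrite foldr_rcons kill //.
  by rewrite linearD linearZ /=; memv.
- rewrite (leq_ltn_trans dimS) // ltnNge; apply: contraNN vS => le.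
  have /eqP -> : S == (S + <[v]>)%VS by rewrite eqEdim addvSl.
  by rewrite (subvP (addvSr S _)) ?memv_line.
Qed.

(** * Traceless multiplication operators *)

Section Trace.
Hypothesis tr0 : forall u, \tr (lin1_mx (mul u)) = 0.

(** This is the power u^(k+1): the index starts at the first power. *)
Let pw u k := iter k (mul u) u.
(** Matrices act on row vectors from the right, so a product applies its left factor first. *)
Let Lmx u := lin1_mx (mul u).

Lemma mulmx_Lmx u v : v *m Lmx u = u • v.
Proof. by rewrite /Lmx mul_rV_lin1. Qed.

Lemma iter_Lmx u v k : iter k (mul u) v = v *m Lmx u ^+ k.
Proof.
elim: k => [|k IHk]; first by rewrite mulmx1.
by rewrite exprSr mulmxA -IHk mulmx_Lmx.
Qed.

Lemma sq_pw u k : (u • u) • pw u k = pw u k.+2.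
Proof.
elim: k => [|k IHk]; first by rewrite mulC.
by rewrite /pw iterS -L_sq_comm IHk.
Qed.

(** This is [L_mulE] for the factorization u^(k+3) = u^(k+1) u^2. *)
Lemma Lmx_pwSS u k : Lmx (pw u k.+2) = Lmx (u • u) * Lmx (pw u k) +
  (Lmx (pw u k.+1) * Lmx u) *+ 2 - (Lmx u * Lmx (pw u k) * Lmx u) *+ 2.
Proof.
apply/row_matrixP => i; rewrite !rowE; move: (delta_mx _ _) => v.
rewrite mulmxBr mulmxDr !mulr2n !mulmxDr !mulmxA !mulmx_Lmx.
rewrite -sq_pw (mulC (u • u)) L_mulE (mulC _ u).
by apply/rowP => j; rewrite !mxE; lra.
Qed.

(** By the recurrence, [Lmx (pw u k)] is a polynomial in [Lmx u] and [Lmx (u • u)], which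
    commute. *)
Lemma Lmx_pw_comm u k : Lmx u * Lmx (pw u k) = Lmx (pw u k) * Lmx u /\
  Lmx (u • u) * Lmx (pw u k) = Lmx (pw u k) * Lmx (u • u).
Proof.
have c01 : Lmx u * Lmx (u • u) = Lmx (u • u) * Lmx u.
  apply/row_matrixP => i; rewrite !rowE; move: (delta_mx _ _) => v.
  by rewrite !mulmxA !mulmx_Lmx L_sq_comm.
have commL x : GRing.comm x (Lmx u) -> GRing.comm x (Lmx (u • u)) ->
    GRing.comm x (Lmx (pw u k)).
  move=> x0 x1; elim/ltn_ind: k => -[_|[_|k IHk]] //.
  rewrite Lmx_pwSS; apply: commrB; first apply: commrD.
  - by apply: commrM => //; exact: IHk.
  - by apply/commrMn/commrM => //; exact: IHk.
  - by apply/commrMn/commrM => //; apply/commrM => //; exact: IHk.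
by split; apply: commL.
Qed.

Lemma Lmx_nilpotent u : exists k, Lmx u ^+ k = 0.
Proof.
(* Q is chosen so that the multiplications by powers of u obey the Lucas recurrence, as [recA]
   states. *)
pose L := Lmx u; pose Q := Lmx (u • u) - (L * L) *+ 2.
have c01 : L * Lmx (u • u) = Lmx (u • u) * L by have [] := Lmx_pw_comm u 1.
have LQ : L * Q = Q * L.
  by rewrite /Q mulrBr mulrBl c01 mulrnAr mulrnAl mulrA.
have defA1 : Lmx (u • u) = Q + (L * L) *+ 2 by rewrite subrK.
move: Q LQ defA1 => Q LQ defA1.
have recA k : Lmx (pw u k.+2) = L *+ 2 * Lmx (pw u k.+1) + Q * Lmx (pw u k).
  have [ck _] := Lmx_pw_comm u k; have [ck1 _] := Lmx_pw_comm u k.+1.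
  rewrite Lmx_pwSS -ck1 ck defA1 mulrDl -/L !mulrnAl.
  rewrite -[Lmx (pw u k) * L * L]mulrA.
  have -> : Lmx (pw u k) * (L * L) = L * L * Lmx (pw u k).
    by rewrite mulrA -ck -mulrA -ck mulrA.
  by rewrite addrAC addrK addrC.
(* As alpha beta = - Q, the right-hand side is the power sum alpha^(k+2) + beta^(k+2). *)
have trlucas k : Lmx (pw u k.+1) *+ 2 = lucas L Q k.+2 + Q * lucas L Q k.
  elim/ltn_ind: k => -[_|[_|k IHk]].
  - rewrite /pw /= defA1 mulr1 mulrnAl mulrnAr.
    by apply/matrixP => i j; rewrite !mulr2n !mxE; lra.
  - have -> : Lmx (pw u 2) = L *+ 2 * (Q + L * L *+ 2) + Q * L.
      by rewrite recA -defA1.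
    rewrite /= mulr1 !(mulrDr, mulrnAl, mulrnAr) LQ !mulrA.
    by apply/matrixP => i j; rewrite !mulr2n !mxE; lra.
  - have -> : Lmx (pw u k.+3) *+ 2 =
        L *+ 2 * (Lmx (pw u k.+2) *+ 2) + Q * (Lmx (pw u k.+1) *+ 2).
      by rewrite recA mulrnDl -!mulrnAr.
    have distr a b c d : L *+ 2 * (a + Q * b) + Q * (c + Q * d) =
        L *+ 2 * a + Q * c + Q * (L *+ 2 * b + Q * d).
      by rewrite !mulrDr addrACA !mulrA !(mulrnAl, mulrnAr) LQ.
    by rewrite !IHk // distr -!lucasSS.
(* The companion matrix of t^2 = 2 L t + Q. *)
pose P : 'M[F]_(n + n) := block_mx (L *+ 2) Q 1 0.
have PSS k : P ^+ k.+2 = block_mx (lucas L Q k.+2) (lucas L Q k.+1 * Q)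
    (lucas L Q k.+1) (lucas L Q k * Q).
  elim: k => [|k IHk].
    rewrite expr2 -mulmxE mulmx_block !mulmxE !(mulr0, mul1r, mul0r, addr0, mulr1).
    by rewrite lucasSS mulr1.
  rewrite exprS IHk -mulmxE mulmx_block !mulmxE !(mul1r, mul0r, addr0).
  by rewrite !mulrA -mulrDl.
(* P has trace 2 tr L, and P^(k+2) has by [trlucas] twice the trace of the multiplication by
   u^(k+2). *)
have [|k Pk] := @nilpotent_mxtrace _ _ P.
  case=> [|k].
    by rewrite expr1 mxtrace_block mxtrace0 addr0 mulr2n mxtraceD /L tr0 addr0.
  rewrite PSS mxtrace_block -mulmxE [X in _ + X]mxtrace_mulC mulmxE -mxtraceD.
  by rewrite -trlucas mulr2n mxtraceD tr0 addr0.
(* The exponent is raised into the range of [PSS], whose left blocks are two consecutive Lucas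
   terms. *)
have Pk2 : P ^+ k.+2 = 0 by rewrite -addn2 exprD Pk mul0r.
have: block_mx (lucas L Q k.+2) (lucas L Q k.+1 * Q)
    (lucas L Q k.+1) (lucas L Q k * Q) = 0 by rewrite -PSS.
rewrite -[RHS]block_mx0 => /eq_block_mx[pk2 _ pk1 _].
exact: lucas_nilpotent LQ pk1 pk2.
Qed.

Lemma jordan_tr0_nilpotent : nilpotent_algebra mul.
Proof.
have nilL := Lmx_nilpotent.
apply/engel_nilpotent/engel_full => u; have [k Lk] := nilL u; last first.
  by exists k => v; rewrite iter_Lmx Lk mulmx0.
(* Power associativity turns iterated squaring of u into the powers u^(2^i). *)
have pwM i j : pw u i • pw u j = pw u (i + j).+1.
  elim: j => [|j IHj]; first by rewrite addn0 mulC.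
  have [cL _] := Lmx_pw_comm u i.
  have -> : pw u i • pw u j.+1 = u • (pw u i • pw u j).
    rewrite -[pw u j.+1]/(u • pw u j) -(mulmx_Lmx (pw u i)) -(mulmx_Lmx u).
    by rewrite -mulmxA mulmxE cL -mulmxE mulmxA !mulmx_Lmx.
  by rewrite IHj addnS.
have sq_iter i : iter i (fun z => z • z) u = pw u (2 ^ i).-1.
  elim: i => [//|i IHi]; rewrite iterS IHi pwM expnS mul2n -addnn.
  by case: (2 ^ i)%N (expn_gt0 2 i) => // m _; rewrite /= addnS.
exists k; rewrite sq_iter /pw -(subnK (_ : k <= (2 ^ k).-1)%N).
  by rewrite iterD (iter_Lmx _ _ k) Lk mulmx0 iter_Lmx mul0mx.
have lt : (k < 2 ^ k)%N by exact: ltn_expl.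
by rewrite -ltnS (ltn_predK lt).
Qed.

End Trace.

End NilpotentJordan.

(** * Calculus *)

Section Derivatives.
Context {R : realType} {V : normedModType R}.

Lemma is_derive_line (W : normedModType R) (f : V -> W) (y u : V) (s : R) :
  derivable f (y + s *: u) u ->
  is_derive s 1 (fun r : R => f (y + r *: u)) ('D_u f (y + s *: u)).
Proof.
have E : (fun h : R => h^-1 *: (((fun r : R => f (y + r *: u)) \o shift s) (h *: 1)
    - f (y + s *: u))) =
  (fun h : R => h^-1 *: ((f \o shift (y + s *: u)) (h *: u) - f (y + s *: u))).
  apply/funext => h /=; congr (_ *: (f _ - _)).
  by rewrite scalerDl [h *: 1]mulr1 addrCA.
by move=> df; apply: DeriveDef; rewrite /derivable /derive E.
Qed.

(** The mean value theorem is applied twice, first along u to [psi], then along v to [phi]. *)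
Lemma second_difference (f : V -> R) (x u v : V) (t : R) : 0 < t ->
  (forall r s : R, 0 <= r <= t -> 0 <= s <= t ->
     derivable f (x + r *: u + s *: v) u /\
     derivable ('D_u f) (x + r *: u + s *: v) v) ->
  exists r s, [/\ 0 < r < t, 0 < s < t &
    f (x + t *: u + t *: v) - f (x + t *: u) - (f (x + t *: v) - f x) =
    'D_v ('D_u f) (x + r *: u + s *: v) * t ^+ 2].
Proof.
move=> t0 df.
pose psi r := f (x + t *: v + r *: u) - f (x + r *: u).
pose dpsi r := 'D_u f (x + t *: v + r *: u) - 'D_u f (x + r *: u).
have dpsiP r : 0 <= r <= t -> is_derive r 1 psi (dpsi r).
  move=> rt; apply: is_deriveB; apply: is_derive_line.
    rewrite addrAC; have [] // := df r t rt; rewrite ?lexx ?ltW //.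
  have := df r 0 rt; rewrite scale0r addr0; case=> //; rewrite ?lexx ?ltW //.
have [||r rt psiE] := @MVT R psi dpsi 0 t t0.
- by move=> r; rewrite in_itv /= => /andP[/ltW r0 /ltW rt]; apply: dpsiP; rewrite r0.
- apply: derivable_within_continuous => r; rewrite in_itv /= => rt.
  by have [] := dpsiP r rt.
move: rt; rewrite in_itv /= => /andP[r0 rt].
have rt' : 0 <= r <= t by rewrite !ltW.
pose phi s := 'D_u f (x + r *: u + s *: v).
pose dphi s := 'D_v ('D_u f) (x + r *: u + s *: v).
have dphiP s : 0 <= s <= t -> is_derive s 1 phi (dphi s).
  by move=> st; apply: is_derive_line; have [] := df r s rt' st.
have [||s st phiE] := @MVT R phi dphi 0 t t0.
- by move=> s; rewrite in_itv /= => /andP[/ltW s0 /ltW st]; apply: dphiP; rewrite s0.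
- apply: derivable_within_continuous => s; rewrite in_itv /= => st.
  by have [] := dphiP s st.
move: st; rewrite in_itv /= => st.
exists r, s; split; rewrite ?r0 ?rt //.
have -> : f (x + t *: u + t *: v) - f (x + t *: u) - (f (x + t *: v) - f x) =
    psi t - psi 0.
  by rewrite /psi !scale0r !addr0 (addrAC x).
rewrite psiE /dpsi; move: phiE; rewrite /phi /dphi scale0r addr0 (addrAC x) => ->.
by rewrite subr0; ring.
Qed.

(** The second difference over a small parallelogram is symmetric in u and v, and equals t^2 times
    either mixed derivative at a point near x; continuity concludes. *)
Lemma derive_comm_scalar (U : set V) (f : V -> R) (x u v : V) : open U -> U x ->
  (forall w z, U z -> derivable f z w) ->
  (forall w w' z, U z -> derivable ('D_w f) z w') ->
  (forall w w', {for x, continuous ('D_w ('D_w' f))}) ->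
  'D_v ('D_u f) x = 'D_u ('D_v f) x.
Proof.
have subAC (a b c d : R) : a - b - (c - d) = a - c - (b - d) by ring.
have lt2 (q : R) : 0 <= q -> q < 2 * (q + 1) by lra.
move=> oU Ux df ddf cf; apply/eqP/negPn/negP => neq.
pose e := `|'D_v ('D_u f) x - 'D_u ('D_v f) x| / 2.
have e0 : 0 < e by rewrite divr_gt0 // normr_gt0 subr_eq0.
have : \forall z \near x, [/\ U z, `|'D_v ('D_u f) x - 'D_v ('D_u f) z| < e &
    `|'D_u ('D_v f) x - 'D_u ('D_v f) z| < e].
  have n1 : \forall z \near x, U z by exact: open_nbhs_nbhs.
  have n2 : \forall z \near x, `|'D_v ('D_u f) x - 'D_v ('D_u f) z| < e.
    by have /cvgrPdist_lt := cf v u; apply.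
  have n3 : \forall z \near x, `|'D_u ('D_v f) x - 'D_u ('D_v f) z| < e.
    by have /cvgrPdist_lt := cf u v; apply.
  by apply: filterS3 n1 n2 n3 => z Uz; split.
move=> /nbhs_ballP [d /= d0 near_x].
(* This keeps the parallelogram within distance d of x, also when u = v = 0. *)
pose t := d / (2 * (`|u| + `|v| + 1)).
have c0 : 0 < 2 * (`|u| + `|v| + 1).
  by rewrite mulr_gt0 // ltr_wpDl // addr_ge0.
have t0 : 0 < t by rewrite divr_gt0.
have inball w w' r s : `|w| + `|w'| = `|u| + `|v| ->
    0 <= r <= t -> 0 <= s <= t -> ball x d (x + r *: w + s *: w').
  move=> ww /andP[r0 rt] /andP[s0 st]; rewrite -ball_normE /ball_ /=.
  rewrite -addrA opprD addNKr normrN.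
  apply: (le_lt_trans (ler_normD _ _)); rewrite !normrZ (ger0_norm r0) (ger0_norm s0).
  apply: (@le_lt_trans _ _ (t * (`|u| + `|v|))).
    by rewrite -ww mulrDr lerD // ler_wpM2r.
  rewrite /t -mulrA gtr_pMr // mulrC ltr_pdivrMr // mul1r.
  by rewrite lt2 // addr_ge0.
have sd w w' : `|w| + `|w'| = `|u| + `|v| -> exists r s, [/\ 0 < r < t, 0 < s < t &
    f (x + t *: w + t *: w') - f (x + t *: w) - (f (x + t *: w') - f x) =
    'D_w' ('D_w f) (x + r *: w + s *: w') * t ^+ 2].
  move=> ww; apply: second_difference => // r s rt st.
  by have [Uz _ _] := near_x _ (inball _ _ _ _ ww rt st); split; [exact: df|exact: ddf].
have [r [s [/andP[r0 rt] /andP[s0 st] E1]]] := sd u v erefl.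
have [r' [s' [/andP[r0' rt'] /andP[s0' st'] E2]]] := sd v u (addrC _ _).
have itv q : 0 < q -> q < t -> 0 <= q <= t by move=> q0 qt; rewrite !ltW.
have [_ L1 _] := near_x _ (inball u v r s erefl (itv _ r0 rt) (itv _ s0 st)).
have [_ _ L2] := near_x _ (inball v u r' s' (addrC _ _) (itv _ r0' rt') (itv _ s0' st')).
have E : 'D_v ('D_u f) (x + r *: u + s *: v) = 'D_u ('D_v f) (x + r' *: v + s' *: u).
  apply: (mulIf (lt0r_neq0 (exprn_gt0 2 t0))).
  apply: etrans (esym E1) (etrans _ E2); rewrite (addrAC x).
  exact: subAC.
move: L1 L2; rewrite {}E; move: ('D_u ('D_v f) (_ + _ + _)) => m L1 L2.
have := ler_distD m ('D_v ('D_u f) x) ('D_u ('D_v f) x).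
by rewrite (distrC m) leNgt (lt_le_trans (ltrD L1 L2)) // /e -splitr.
Qed.

Lemma derivable_coord n (f : V -> 'rV[R]_n) x v j : derivable f x v ->
  derivable (fun z => f z 0 j : R) x v.
Proof. by move=> /derivable_mxP; apply. Qed.

Lemma derive_coord n (f : V -> 'rV[R]_n) x v j : derivable f x v ->
  'D_v (fun z => f z 0 j : R) x = 'D_v f x 0 j.
Proof. by move=> /derive_mx ->; rewrite mxE. Qed.

Lemma derive_comm (n : nat) (U : set V) (f : V -> 'rV[R]_n) (x u v : V) :
  open U -> U x -> smooth_on U f ->
  'D_v (fun z => 'D_u f z) x = 'D_u (fun z => 'D_v f z) x.
Proof.
move=> oU Ux sf; have /= [df sf1] := sf 2.
have ddf w z : U z -> differentiable (fun y => 'D_w f y) z.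
  by have [dw _] := sf1 w; exact: dw.
have cddf w w' z : U z -> {for z, continuous (fun y => 'D_w (fun t => 'D_w' f t) y)}.
  by move=> Uz; have [_ cw] := sf1 w'; exact: cw.
have E1 w j z : U z -> 'D_w (fun y => f y 0 j : R) z = 'D_w f z 0 j.
  by move=> Uz; apply/derive_coord/diff_derivable/df.
have nE1 w j z : U z -> \forall y \near z, 'D_w f y 0 j = 'D_w (fun y => f y 0 j : R) y.
  move=> Uz; have : \forall y \near z, U y by exact: open_nbhs_nbhs.
  by apply: filterS => y /E1 ->.
have E2 w w' j z : U z -> 'D_w (fun y => 'D_w' (fun y => f y 0 j : R) y) z =
    'D_w (fun y => 'D_w' f y) z 0 j.
  move=> Uz; rewrite -derive_coord; last exact/diff_derivable/ddf.
  by apply/esym/near_eq_derive/nE1.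
have nE2 w w' j z : U z -> \forall y \near z, 'D_w (fun y => 'D_w' f y) y 0 j =
    'D_w (fun y => 'D_w' (fun y => f y 0 j : R) y) y.
  move=> Uz; have : \forall y \near z, U y by exact: open_nbhs_nbhs.
  by apply: filterS => y /E2 ->.
apply/rowP => j; apply: etrans (esym (E2 v u j x Ux)) (etrans _ (E2 u v j x Ux)).
apply: (@derive_comm_scalar U (fun y => f y 0 j : R) x u v oU Ux).
- by move=> w z Uz; apply/derivable_coord/diff_derivable/df.
- move=> w w' z Uz; apply: near_eq_derivable (nE1 w j z Uz) _.
  by apply/derivable_coord/diff_derivable/ddf.
- move=> w w'.
  have cv : (fun y => 'D_w (fun y => 'D_w' (fun y => f y 0 j : R) y) y) @ x -->
      ('D_w (fun y => 'D_w' f y) x 0 j : R).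
    apply: cvg_trans (near_eq_cvg (nE2 w w' j x Ux)) _.
    have := @coord_continuous R 1 n 0 j ('D_w (fun y => 'D_w' f y) x).
    by apply: cvg_comp; exact: cddf.
  by move: cv; rewrite -(E2 w w' j x Ux).
Qed.

Lemma is_deriveZ (W : normedModType R) (f : V -> R) (g : V -> W) (x v : V) df dg :
  is_derive x v f df -> is_derive x v g dg ->
  is_derive x v (fun z => f z *: g z) (f x *: dg + df *: g x).
Proof.
move=> [df' <-] [dg' <-].
suff H : (fun h : R => h^-1 *: (((fun z => f z *: g z) \o shift x) (h *: v) - f x *: g x))
    @ 0^' --> f x *: 'D_v g x + 'D_v f x *: g x.
  by apply: DeriveDef; [apply/cvg_ex; eexists; exact: H | exact: cvg_lim H].
have -> : (fun h : R => h^-1 *: (((fun z => f z *: g z) \o shift x) (h *: v) - f x *: g x)) =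
   (fun h : R => f (h *: v + x) *: (h^-1 *: (g (h *: v + x) - g x)) +
     (h^-1 *: (f (h *: v + x) - f x)) *: g x).
  apply/funext => h /=; rewrite [_ *: (f _ - f x)]/(_ * _) -(scalerA h^-1).
  rewrite [f _ *: (_ *: _)]scalerA (mulrC _ h^-1) -(scalerA h^-1) -scalerDr.
  by rewrite [f _ *: (g _ - _)]scalerBr scalerBl subrKA.
apply: cvgD; last by apply: cvgZr_tmp; exact: df'.
apply: cvgZ; last exact: dg'.
suff : {for 0, continuous (fun h : R => f (h *: v + x))}.
  by move=> /continuous_withinNx; rewrite scale0r add0r.
exact/differentiable_continuous/derivable1_diffP/(derivable1P _ _ _).1.
Qed.

(** Leibniz rule for a field of linear maps applied to a moving vector; linearity near x is
    expressed by the expansion over the standard basis. *)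
Lemma is_derive_app (W : normedModType R) n (L : V -> 'rV[R]_n -> W)
    (X : V -> 'rV[R]_n) (x v : V) dX :
  (\forall z \near x, forall a : 'rV[R]_n, L z a = \sum_j a 0 j *: L z (delta_mx 0 j)) ->
  (forall a, derivable (L ^~ a) x v) -> is_derive x v X dX ->
  is_derive x v (fun z => L z (X z)) ('D_v (L ^~ (X x)) x + L x dX).
Proof.
move=> linL dL [dX' <-].
have E (Y : V -> 'rV[R]_n) : derivable Y x v ->
    is_derive x v (fun z => L z (Y z)) (\sum_j (Y x 0 j *: 'D_v (L ^~ (delta_mx 0 j)) x +
      'D_v Y x 0 j *: L x (delta_mx 0 j))).
  move=> dY.
  have near_sum : \forall z \near x,
      (\sum_j (fun z => Y z 0 j *: L z (delta_mx 0 j))) z = L z (Y z).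
    by apply: filterS linL => z ->; rewrite fct_sumE.
  apply: near_eq_is_derive near_sum _; apply: is_derive_sum => j.
  apply: is_deriveZ.
    by rewrite -derive_coord //; apply/derivableP/derivable_coord.
  exact/derivableP/dL.
apply: is_derive_eq (E X dX') _; rewrite big_split /=; congr (_ + _); last first.
  by rewrite (nbhs_singleton linL).
have [_ ->] := E (fun=> X x) (derivable_cst _ _ _).
by apply: eq_bigr => j _; rewrite derive_cst mxE scale0r addr0.
Qed.

Lemma is_derive_prod n (F : 'I_n -> V -> R) (F' : 'I_n -> R) (x v : V) :
  (forall i, is_derive x v (F i) (F' i)) ->
  is_derive x v (fun z => \prod_i F i z)
    (\sum_i \prod_j (if j == i then F' j else F j x)).
Proof.
elim: n F F' => [|n IHn] F F' dF.
  rewrite big_ord0; under eq_fun do rewrite big_ord0; exact: is_derive_cst.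
have -> : (fun z => \prod_i F i z) =
    F ord0 * (fun z => \prod_i F (lift ord0 i) z).
  by apply/funext => z; rewrite big_ord_recl.
have dP := is_deriveM (dF ord0) (IHn _ _ (fun i => dF (lift ord0 i))).
apply: is_derive_eq dP _.
rewrite big_ord_recl addrC; congr (_ + _).
  by rewrite big_ord_recl eqxx mulrC.
rewrite scaler_sumr; apply: eq_bigr => i _; rewrite big_ord_recl /=.
by congr (_ * _); apply: eq_bigr => j _; rewrite (inj_eq lift_inj).
Qed.

(** Jacobi's formula: the determinant is differentiated one row at a time, and expanding along that
    row produces the adjugate. *)
Lemma is_derive_det n (M : V -> 'M[R]_n) (M' : 'M[R]_n) (x v : V) :
  (forall i j, is_derive x v (fun z => M z i j) (M' i j)) ->
  is_derive x v (fun z => \det (M z)) (\tr (M' *m \adj (M x))).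
Proof.
move=> dM.
have -> : (fun z => \det (M z)) =
    \sum_(s : 'S_n) (fun z => (-1) ^+ s *: \prod_i M z i (s i)).
  by apply/funext => z; rewrite fct_sumE.
pose Mi i : 'M[R]_n := \matrix_(j, k) (if j == i then M' j k else M x j k).
have -> : \tr (M' *m \adj (M x)) = \sum_i \det (Mi i).
  apply: eq_bigr => i _; rewrite mxE (expand_det_row _ i); apply: eq_bigr => k _.
  rewrite !mxE eqxx; congr (_ * (_ * \det _)); apply/matrixP => j l.
  by rewrite !mxE eq_sym (negbTE (neq_lift _ _)).
rewrite /determinant exchange_big /=.
elim/big_ind2 : _ => [|f df g dg f' g'|s _]; [exact: is_derive_cst|exact: is_deriveD|].
apply: is_derive_eq (is_deriveZ (is_derive_cst _ x v)
  (is_derive_prod (fun i => dM i (s i)))) _.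
rewrite scale0r addr0 scaler_sumr; apply: eq_bigr => i _.
by congr (_ * _); apply: eq_bigr => j _; rewrite mxE.
Qed.

End Derivatives.

(** * Bilinear maps in coordinates *)

Section Bilinear.
Variables (R : realType) (n : nat) (W : lmodType R).
Variable b : 'rV[R]_n -> 'rV[R]_n -> W.
Hypothesis bP : is_bilinear b.

Lemma bilinl a u u' v : b (a *: u + u') v = a *: b u v + b u' v.
Proof. by case: bP => + _; apply. Qed.

Lemma bilinr a u v v' : b u (a *: v + v') = a *: b u v + b u v'.
Proof. by case: bP => _; apply. Qed.

Lemma bilin_suml u v : b u v = \sum_j u 0 j *: b (delta_mx 0 j) v.
Proof.
pose f : {linear 'rV[R]_n -> W} :=
  HB.pack (b ^~ v) (GRing.isLinear.Build _ _ _ _ _ (fun a u u' => bilinl a u u' v)).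
rewrite {1}[u]row_sum_delta -[LHS]/(f _) linear_sum.
by apply: eq_bigr => j _; rewrite linearZ.
Qed.

Lemma bilin_sumr u v : b u v = \sum_j v 0 j *: b u (delta_mx 0 j).
Proof.
pose f : {linear 'rV[R]_n -> W} :=
  HB.pack (b u) (GRing.isLinear.Build _ _ _ _ _ (fun a v v' => bilinr a u v v')).
rewrite {1}[v]row_sum_delta -[LHS]/(f _) linear_sum.
by apply: eq_bigr => j _; rewrite linearZ.
Qed.

Lemma bilinDl u u' v : b (u + u') v = b u v + b u' v.
Proof. by rewrite -[u in LHS]scale1r bilinl scale1r. Qed.

Lemma bilinDr u v v' : b u (v + v') = b u v + b u v'.
Proof. by rewrite -[v in LHS]scale1r bilinr scale1r. Qed.

Lemma bilin0l v : b 0 v = 0.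
Proof. by rewrite bilin_suml big1 // => j _; rewrite mxE scale0r. Qed.

Lemma bilinNl u v : b (- u) v = - b u v.
Proof.
by rewrite -[LHS]addr0 -(subrr (b u v)) addrA -bilinDl addNr bilin0l add0r.
Qed.

Lemma bilinBl u u' v : b (u - u') v = b u v - b u' v.
Proof. by rewrite -[- u']scaleN1r [u + _]addrC bilinl scaleN1r addrC. Qed.

Lemma bilinBr u v v' : b u (v - v') = b u v - b u v'.
Proof. by rewrite -[- v']scaleN1r [v + _]addrC bilinr scaleN1r addrC. Qed.

End Bilinear.

(** Squaring removes the absolute value: p^2 = q^4 is differentiated and compared. *)
Lemma log_derivative_sq (R : realType) (V : normedModType R) (p q : V -> R)
    (x w : V) (a b : R) :
  is_derive x w p (2 * a * p x) -> is_derive x w q (b * q x) ->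
  (\forall z \near x, q z ^+ 2 = `|p z|) -> p x != 0 -> a = b.
Proof.
move=> dp dq qp px0.
have E : \forall z \near x, (p * p) z = ((q * q) * (q * q)) z.
  apply: filterS qp => z qz; rewrite -[LHS]/(p z * p z).
  rewrite -[RHS]/((q z * q z) * (q z * q z)) -!expr2 qz -normrX.
  by rewrite ger0_norm // sqr_ge0.
have qx : p x * p x = (q x * q x) * (q x * q x) by exact: (nbhs_singleton E).
have := near_eq_derive w E.
have [_ ->] := is_deriveM dp dp.
have [_ ->] := is_deriveM (is_deriveM dq dq) (is_deriveM dq dq).
rewrite -[LHS]/(p x * (2 * a * p x) + p x * (2 * a * p x)).
rewrite -[RHS]/((q x * q x) * (q x * (b * q x) + q x * (b * q x)) +
  (q x * q x) * (q x * (b * q x) + q x * (b * q x))).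
move: (p x) (q x) px0 qx => s t s0 st e.
have : s * s * (a - b) = 0.
  suff : 4 * (s * s * a) = 4 * ((t * t) * (t * t) * b) by rewrite -st; lra.
  by move: e; lra.
by move/eqP; rewrite !mulf_eq0 (negbTE s0) /= subr_eq0 => /eqP.
Qed.

(** * Geometry in a chart *)

Section ChartGeometry.
Variables (R : realType) (n : nat) (U : set 'rV[R]_n).
Variables (g : 'rV[R]_n -> 'rV[R]_(n + 1)) (xi : 'rV[R]_(n + 1)).
Variables (G Gh : 'rV[R]_n -> 'rV[R]_n -> 'rV[R]_n -> 'rV[R]_n).
Variable h : 'rV[R]_n -> 'rV[R]_n -> 'rV[R]_n -> R.
Hypothesis openU : open U.
Hypothesis smooth_g : smooth_on U g.
Hypothesis immersed : forall x u, U x -> 'D_u g x = 0 -> u = 0.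
Hypothesis transverse : forall x u, U x -> 'D_u g x <> xi.
Hypothesis bilG : forall x, U x -> is_bilinear (G x).
Hypothesis smoothG : forall u v, smooth_on U (fun x => G x u v).
Hypothesis bilh : forall x, U x -> is_bilinear (h x : _ -> _ -> R^o).
Hypothesis smoothh : forall u v, smooth_on U (fun x => h x u v).
Hypothesis gauss : forall x u v, U x ->
  'D_u (fun z => 'D_v g z) x = 'D_(G x u v) g x + h x u v *: xi.
Hypothesis h_nondeg : forall x u, U x -> (forall v, h x u v = 0) -> u = 0.
Hypothesis bilGh : forall x, U x -> is_bilinear (Gh x).
Hypothesis smoothGh : forall u v, smooth_on U (fun x => Gh x u v).
Hypothesis GhC : forall x u v, U x -> Gh x u v = Gh x v u.
Hypothesis metric : forall x w u v, U x ->
  'D_w (fun z => h z u v) x = h x (Gh x w u) v + h x u (Gh x w v).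

Variable K : 'rV[R]_n -> 'rV[R]_n -> 'rV[R]_n -> 'rV[R]_n.
(* K is not a definition, so that [mxE] cannot unfold it. *)
Hypothesis KE : forall x u v, K x u v = G x u v - Gh x u v.

Local Notation V := 'rV[R]_n.

Lemma nearU x : U x -> \forall z \near x, U z.
Proof. by move=> Ux; apply: open_nbhs_nbhs. Qed.

Lemma smooth_derivable (W : normedModType R) (f : V -> W) x w :
  smooth_on U f -> U x -> derivable f x w.
Proof. by move=> /(_ 1) [df _] Ux; apply/diff_derivable/df. Qed.

Lemma Dg_linear x a u v : U x ->
  'D_(a *: u + v) g x = a *: 'D_u g x + 'D_v g x.
Proof.
move=> Ux; have dg : differentiable g x by have [dg _] := smooth_g 1; exact: dg.
by rewrite !deriveE // linearP.
Qed.

Lemma Dg_sum x u : U x -> 'D_u g x = \sum_j u 0 j *: 'D_(delta_mx 0 j) g x.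
Proof.
move=> Ux; pose f : {linear V -> 'rV[R]_(n + 1)} :=
  HB.pack (fun u => 'D_u g x)
    (GRing.isLinear.Build _ _ _ _ _ (fun a u v => Dg_linear a u v Ux)).
rewrite {1}[u]row_sum_delta -[LHS]/(f _) linear_sum.
by apply: eq_bigr => j _; rewrite linearZ.
Qed.

(** If a and b differed, a rescaled tangent vector would equal [xi], against transversality; then
    injectivity of the differential gives u = v. *)
Lemma frame_inj x u v (a b : R) : U x ->
  'D_u g x + a *: xi = 'D_v g x + b *: xi -> u = v /\ a = b.
Proof.
move=> Ux E; have Duv : 'D_(u - v) g x = (b - a) *: xi.
  rewrite -[- v]scaleN1r [u + _]addrC Dg_linear // scaleN1r [LHS]addrC.
  have -> : 'D_u g x = 'D_v g x + b *: xi - a *: xi by rewrite -E addrK.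
  by rewrite scalerBl [LHS]addrC -addrA addKr.
have [ab|ab] := eqVneq a b; last first.
  have ba : b - a != 0 by rewrite subr_eq0 eq_sym.
  have /(transverse Ux) [] : 'D_((b - a)^-1 *: (u - v)) g x = xi.
  by rewrite -[_ *: _]addr0 Dg_linear // derive0 addr0 Duv scalerA mulVf // scale1r.
split=> //; apply/eqP; rewrite -subr_eq0; apply/eqP/(immersed Ux).
by rewrite Duv ab subrr scale0r.
Qed.

Lemma GC_hC x u v : U x -> G x u v = G x v u /\ h x u v = h x v u.
Proof.
move=> Ux; apply: (frame_inj Ux); rewrite -(gauss u v Ux) -(gauss v u Ux).
exact: (derive_comm _ _ openU Ux smooth_g).
Qed.

Lemma GC x u v : U x -> G x u v = G x v u.
Proof. by move=> /(GC_hC u v) []. Qed.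

Lemma hC x u v : U x -> h x u v = h x v u.
Proof. by move=> /(GC_hC u v) []. Qed.

Lemma D3g x w u v : U x -> 'D_w (fun z => 'D_u (fun y => 'D_v g y) z) x =
  'D_('D_w (fun z => G z u v) x + G x w (G x u v)) g x +
  ('D_w (fun z => h z u v) x + h x w (G x u v)) *: xi.
Proof.
move=> Ux.
have E : \forall z \near x,
    'D_(G z u v) g z + h z u v *: xi = 'D_u (fun y => 'D_v g y) z.
  by apply: filterS (nearU Ux) => z Uz; rewrite gauss.
rewrite -(near_eq_derive _ E).
have dG : is_derive x w (fun z => G z u v) ('D_w (fun z => G z u v) x).
  by apply/derivableP/smooth_derivable.
have dh : is_derive x w (fun z => h z u v) ('D_w (fun z => h z u v) x).
  by apply/derivableP/smooth_derivable.
have d1 : is_derive x w (fun z => 'D_(G z u v) g z)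
    ('D_w (fun z => 'D_(G x u v) g z) x + 'D_('D_w (fun z => G z u v) x) g x).
  apply: (is_derive_app (L := fun z a => 'D_a g z)) dG.
    by apply: filterS (nearU Ux) => z Uz a; exact: Dg_sum.
  by move=> a; apply: smooth_derivable Ux => k; have [_] := smooth_g k.+1; apply.
have d2 := is_deriveZ dh (is_derive_cst xi x w).
have [_ ->] := is_deriveD d1 d2.
have sumE (a b c d : 'rV[R]_(n + 1)) : a + b + c + d = c + a + (d + b).
  by rewrite [RHS]addrACA [RHS]addrC addrA.
rewrite (gauss w (G x u v) Ux) scaler0 add0r sumE scalerDl; congr (_ + _).
by rewrite -['D_w _ x in RHS]scale1r Dg_linear // scale1r.
Qed.

(** Third derivatives of [g] are symmetric in w and u: the tangential part is the flatness of nabla,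
    the transversal part the Codazzi equation. *)
Lemma flat_codazzi x w u v : U x ->
  'D_w (fun z => G z u v) x + G x w (G x u v) =
  'D_u (fun z => G z w v) x + G x u (G x w v) /\
  'D_w (fun z => h z u v) x + h x w (G x u v) =
  'D_u (fun z => h z w v) x + h x u (G x w v).
Proof.
move=> Ux; apply: (frame_inj Ux); rewrite -(D3g w u v Ux) -(D3g u w v Ux).
apply: (derive_comm _ _ openU Ux) => k.
by have [_] := smooth_g k.+1; apply.
Qed.

Lemma bilK x : U x -> is_bilinear (K x).
Proof.
move=> Ux; split=> a u v w.
  rewrite !KE (bilinl (bilG Ux)) (bilinl (bilGh Ux)).
  by rewrite scalerBr opprD addrACA.
rewrite !KE (bilinr (bilG Ux)) (bilinr (bilGh Ux)).
by rewrite scalerBr opprD addrACA.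
Qed.

Lemma KC x u v : U x -> K x u v = K x v u.
Proof. by move=> Ux; rewrite !KE GC // GhC. Qed.

(** Subtracting metric compatibility from the Codazzi equation and using the symmetry of K gives
    h(b, K(a, c)) = h(a, K(b, c)), hence total symmetry. *)
Lemma hK_sym x u v w : U x -> h x (K x u v) w = h x v (K x u w).
Proof.
move=> Ux.
have codazzi a b c : h x (K x a b) c + h x b (K x a c) =
   h x (K x b a) c + h x a (K x b c).
  have [_] := flat_codazzi a b c Ux; rewrite !metric // !KE.
  rewrite !(bilinBl (bilh Ux)) !(bilinBr (bilh Ux)) (GC b a) // (GhC b a) //.
  lra.
have swap a b c : h x (K x a c) b = h x (K x b c) a.
  have := codazzi a b c; rewrite (KC b a Ux) (hC b _ Ux) (hC a _ Ux).
  exact: addrI.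
by rewrite (KC u v Ux) swap (KC w u Ux) (hC _ v Ux).
Qed.

Lemma cubicE x u v w : U x ->
  'D_u (fun z => h z v w) x - h x (G x u v) w - h x v (G x u w) =
  - 2 * h x (K x u v) w.
Proof.
move=> Ux; rewrite metric // KE (bilinBl (bilh Ux)).
have := hK_sym u v w Ux; rewrite !KE (bilinBl (bilh Ux)) (bilinBr (bilh Ux)).
lra.
Qed.

(** * Parallel cubic form and the Jordan identity *)

Let C t w u v := 'D_w (fun z => h z u v) t - h t (G t w u) v - h t u (G t w v).
Hypothesis parallel : forall x z w u v, U x ->
  'D_z (fun t => C t w u v) x - C x (Gh x z w) u v - C x w (Gh x z u) v
    - C x w u (Gh x z v) = 0.

Lemma is_derive_Gh x w u v : U x ->
  is_derive x w (fun z => Gh z u v) ('D_w (fun z => Gh z u v) x).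
Proof. by move=> Ux; apply/derivableP/smooth_derivable. Qed.

Lemma is_derive_K x w u v : U x ->
  is_derive x w (fun z => K z u v) ('D_w (fun z => K z u v) x).
Proof.
move=> Ux; apply: derivableP; rewrite (_ : (fun z => K z u v) =
    (fun z => G z u v) - (fun z => Gh z u v)); last by apply/funext => z; rewrite KE.
by apply: derivableB; apply: smooth_derivable Ux.
Qed.

(** In coordinates this is hatnabla K = 0: C = -2 h(K(., .), .) and h are parallel, and
    non-degeneracy removes the pairing. *)
Lemma derive_K x a u v : U x -> 'D_a (fun z => K z u v) x =
  K x (Gh x a u) v + K x u (Gh x a v) - Gh x a (K x u v).
Proof.
move=> Ux; apply/eqP; rewrite -subr_eq0; apply/eqP/(h_nondeg Ux) => w.
have dK := is_derive_K a u v Ux.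
have dhK : is_derive x a (fun z => h z (K z u v) w)
    ('D_a (fun z => h z (K x u v) w) x + h x ('D_a (fun z => K z u v) x) w).
  apply: (is_derive_app (L := fun z b => h z b w)) dK.
    by apply: filterS (nearU Ux) => z Uz b; exact: (bilin_suml (bilh Uz)).
  by move=> b; apply: smooth_derivable Ux.
have dC : 'D_a (fun t => C t u v w) x = - 2 * (h x (Gh x a (K x u v)) w +
    h x (K x u v) (Gh x a w) + h x ('D_a (fun z => K z u v) x) w).
  have E : \forall z \near x, cst (- 2) z *: h z (K z u v) w = C z u v w.
    by apply: filterS (nearU Ux) => z Uz; rewrite /C cubicE.
  rewrite -(near_eq_derive _ E) -metric //.
  have [_ ->] := is_deriveZ (is_derive_cst (- 2 : R) x a) dhK.
  by rewrite scale0r addr0.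
have := parallel a u v w Ux; rewrite dC /C !cubicE //.
rewrite (bilinBl (bilh Ux)) (bilinBl (bilh Ux)) (bilinDl (bilh Ux)).
lra.
Qed.

Lemma derive_K_comm x a b u v : U x ->
  'D_b (fun z => 'D_a (fun y => K y u v) z) x =
  'D_a (fun z => 'D_b (fun y => K y u v) z) x.
Proof.
move=> Ux.
have E w z : U z -> 'D_w (fun y => K y u v) z =
    'D_w (fun y => G y u v) z - 'D_w (fun y => Gh y u v) z.
  move=> Uz; rewrite (_ : (fun z => K z u v) = (fun z => G z u v) - (fun z => Gh z u v)).
    by apply: deriveB; apply: smooth_derivable Uz.
  by apply/funext => y; rewrite KE.
have E2 w w' : 'D_w' (fun z => 'D_w (fun y => K y u v) z) x =
    'D_w' (fun z => 'D_w (fun y => G y u v) z) x -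
    'D_w' (fun z => 'D_w (fun y => Gh y u v) z) x.
  have En : \forall z \near x, 'D_w (fun y => K y u v) z =
     ((fun z => 'D_w (fun y => G y u v) z) - (fun z => 'D_w (fun y => Gh y u v) z)) z.
    by apply: filterS (nearU Ux) => z /E ->.
  rewrite (near_eq_derive _ En); apply: deriveB; apply: smooth_derivable Ux => k.
    by have [_] := smoothG u v k.+1; apply.
  by have [_] := smoothGh u v k.+1; apply.
have e1 := derive_comm b a openU Ux (smoothG u v).
have e2 := derive_comm b a openU Ux (smoothGh u v).
exact (etrans (E2 a b) (etrans (esym (f_equal2 (fun p q => p - q) e1 e2)) (esym (E2 b a)))).
Qed.

Let dGh x w u v := 'D_w (fun z => Gh z u v) x.

Lemma derive_K_app x b (X : V -> V) dX v : U x -> is_derive x b X dX ->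
  is_derive x b (fun z => K z (X z) v)
    (K x (Gh x b (X x)) v + K x (X x) (Gh x b v) - Gh x b (K x (X x) v) + K x dX v).
Proof.
move=> Ux dXx; rewrite -derive_K //.
apply: (is_derive_app (L := fun z c => K z c v)) dXx.
  by apply: filterS (nearU Ux) => z Uz c; exact: (bilin_suml (bilK Uz)).
by move=> c; have [] := is_derive_K b c v Ux.
Qed.

Lemma derive2_K x a b u v : U x ->
  'D_b (fun z => 'D_a (fun y => K y u v) z) x =
  K x (Gh x b (Gh x a u)) v + K x (Gh x a u) (Gh x b v) - Gh x b (K x (Gh x a u) v) +
    K x (dGh x b a u) v +
  (K x (Gh x b (Gh x a v)) u + K x (Gh x a v) (Gh x b u) - Gh x b (K x (Gh x a v) u) +
    K x (dGh x b a v) u) -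
  (dGh x b a (K x u v) +
   Gh x a (K x (Gh x b u) v + K x u (Gh x b v) - Gh x b (K x u v))).
Proof.
move=> Ux.
have E : \forall z \near x,
    K z (Gh z a u) v + K z (Gh z a v) u - Gh z a (K z u v) =
    'D_a (fun y => K y u v) z.
  by apply: filterS (nearU Ux) => z Uz; rewrite derive_K // (KC _ u).
rewrite -(near_eq_derive _ E).
have d1 := derive_K_app v Ux (is_derive_Gh b a u Ux).
have d2 := derive_K_app u Ux (is_derive_Gh b a v Ux).
have d3 : is_derive x b (fun z => Gh z a (K z u v))
    (dGh x b a (K x u v) + Gh x a ('D_b (fun z => K z u v) x)).
  apply: (is_derive_app (L := fun z c => Gh z a c)) (is_derive_K b u v Ux).
    by apply: filterS (nearU Ux) => z Uz c; exact: (bilin_sumr (bilGh Uz)).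
  by move=> c; have [] := is_derive_Gh b a c Ux.
rewrite derive_K // in d3.
by have [_ ->] := is_deriveB (is_deriveD d1 d2) d3.
Qed.

(** On the left is the curvature of hatnabla. In the flatness of nabla = hatnabla + K the
    derivatives of K cancel because K is parallel, leaving only the commutator. *)
Lemma curvature x a b c : U x ->
  dGh x b a c - dGh x a b c + (Gh x b (Gh x a c) - Gh x a (Gh x b c)) =
  K x a (K x b c) - K x b (K x a c).
Proof.
move=> Ux; have [flat _] := flat_codazzi b a c Ux.
have GE y u v : G y u v = Gh y u v + K y u v by rewrite KE [RHS]addrC subrK.
have dGE w u v : 'D_w (fun z => G z u v) x = dGh x w u v + (K x (Gh x w u) v +
    K x u (Gh x w v) - Gh x w (K x u v)).
  rewrite -derive_K // (_ : (fun z => G z u v) = (fun z => Gh z u v) + (fun z => K z u v)).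
    by apply: deriveD; [have [] := is_derive_Gh w u v Ux | have [] := is_derive_K w u v Ux].
  by apply/funext => z; exact: GE.
move: flat; rewrite !dGE !GE !(bilinDr (bilGh Ux)) !(bilinDr (bilK Ux)) (GhC b a) //.
move: (dGh x) => d flat; apply/rowP => j; move/rowP/(_ j): flat; rewrite !mxE.
lra.
Qed.

(** Ricci identity for the parallel K: the curvature annihilates K, and by [curvature] it is the
    commutator of multiplications. *)
Lemma K_derivation x a b u v : U x ->
  K x a (K x b (K x u v)) - K x b (K x a (K x u v)) =
  K x (K x a (K x b u) - K x b (K x a u)) v +
  K x u (K x a (K x b v) - K x b (K x a v)).
Proof.
move=> Ux; have := derive_K_comm a b u v Ux; rewrite !derive2_K //.
move: (dGh x) (fun c => curvature a b c Ux) => d cur.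
rewrite -!cur (KC u (_ + _)) //.
rewrite !(bilinDl (bilK Ux)) !(bilinNl (bilK Ux)).
rewrite !(bilinBr (bilGh Ux)) !(bilinDr (bilGh Ux)).
rewrite !(KC u (Gh x _ _)) // (KC (Gh x a u) (Gh x b v)) // (KC (Gh x a v)) //.
move=> E; apply/rowP => j; move/rowP/(_ j): E; rewrite !mxE.
lra.
Qed.

Lemma K_jordan x a b c w : U x ->
  K x (K x a b) (K x c w) + K x (K x b c) (K x a w) + K x (K x c a) (K x b w) =
  K x c (K x (K x a b) w) + K x a (K x (K x b c) w) + K x b (K x (K x c a) w).
Proof.
move=> Ux; apply/eqP; rewrite -subr_eq0; apply/eqP/(h_nondeg Ux) => z.
(* The commutator D of [K x w] and [K x z] is a derivation, antisymmetric for
   h; the identity is h (D a) (bc) + h (D b) (ca) + h (D c) (ab) = 0. *)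
pose D c := K x w (K x z c) - K x z (K x w c).
have hD p q : h x (D p) q = - h x p (D q).
  rewrite /D (bilinBl (bilh Ux)) (bilinBr (bilh Ux)) !hK_sym //.
  lra.
(* Total symmetry of h(K(., .), .) moves z to the last slot, where the goal has it. *)
have Dhz p q r : h x (D p) (K x q r) =
    h x (K x p (K x w (K x q r))) z - h x (K x (K x w p) (K x q r)) z.
  rewrite /D (bilinBl (bilh Ux)); move: (K x q r) => s; congr (_ - _).
    by rewrite (hK_sym w (K x z p)) // (KC z p) // (hK_sym p z) // hC.
  by rewrite (KC z (K x w p)) // (hK_sym (K x w p) z) // hC.
have sum0 : h x (D a) (K x b c) + h x (D b) (K x c a) + h x (D c) (K x a b) = 0.
  have Dbc : D (K x b c) = K x (D b) c + K x b (D c) by exact: K_derivation.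
  rewrite hD Dbc (bilinDr (bilh Ux)) (KC (D b) c) // -(hK_sym c a (D b)) //.
  rewrite -(hK_sym b a (D c)) // (KC b a) // (hC (D b)) // (hC (D c)) //.
  lra.
move: sum0; rewrite !Dhz !(bilinBl (bilh Ux)) !(bilinDl (bilh Ux)).
rewrite (KC (K x a b) (K x c w)) // (KC (K x b c) (K x a w)) //.
rewrite (KC (K x c a) (K x b w)) // (KC c w) // (KC a w) // (KC b w) //.
rewrite !(KC _ w) //.
lra.
Qed.

(** * Volume forms and traces *)

Let e (i : 'I_n) : V := delta_mx 0 i.
Let frame (X : 'I_n -> V) x := col_mx (\matrix_(i < n) 'D_(X i) g x) xi.
Let H x := gram_matrix (h x) e.

Hypothesis volume : forall x X, U x ->
  \det (frame X x) ^+ 2 = `|\det (gram_matrix (h x) X)|.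

Lemma det_gram_neq0 x : U x -> \det (H x) != 0.
Proof.
move=> Ux; apply/negP => /det0P [v v0 vH]; move/eqP: v0; apply.
apply: (h_nondeg Ux) => w; rewrite (bilin_sumr (bilh Ux)) big1 // => j _.
rewrite (bilin_suml (bilh Ux)) -[X in _ *: X](_ : (v *m H x) 0 j = _).
  by rewrite vH mxE scaler0.
by rewrite mxE; apply: eq_bigr => k _; rewrite mxE.
Qed.

Lemma is_derive_det_frame x w : U x ->
  is_derive x w (fun z => \det (frame e z))
    (\tr (lin1_mx (G x w)) * \det (frame e x)).
Proof.
move=> Ux.
(* By the Gauss formula the derivative of the frame matrix is N times that matrix; the bottom blocks
   vanish because [xi] is constant. *)
pose N := block_mx (lin1_mx (G x w)) (\col_i h x w (e i)) 0 (0 : 'M[R]_1).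
have dT i j : is_derive x w (fun z => frame e z i j) ((N *m frame e x) i j).
  rewrite /N /frame mul_block_col !mul0mx addr0.
  case: (split_ordP i) => k ->.
    rewrite col_mxEu (_ : (fun z => _) = (fun z => 'D_(e k) g z 0 j)); last first.
      by apply/funext => z; rewrite col_mxEu mxE.
    have dg : derivable (fun z => 'D_(e k) g z) x w.
      by apply: smooth_derivable Ux => l; have [_] := smooth_g l.+1; apply.
    apply: (is_derive_eq (derivableP (derivable_coord (j := j) dg))).
    rewrite derive_coord // gauss // (Dg_sum (G x w (e k))) // !mxE summxE.
    congr (_ + _); last by rewrite big_ord1 !mxE.
    by apply: eq_bigr => l _; rewrite !mxE.
  rewrite col_mxEd (_ : (fun z => _) = cst (xi k j)); last first.
    by apply/funext => z; rewrite col_mxEd.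
  by rewrite mxE; exact: is_derive_cst.
apply: is_derive_eq (is_derive_det dT) _.
rewrite -mulmxA mul_mx_adj mul_mx_scalar mxtraceZ mulrC mxtrace_block.
by rewrite mxtrace0 addr0.
Qed.

Lemma is_derive_det_gram x w : U x ->
  is_derive x w (fun z => \det (H z))
    (2 * \tr (lin1_mx (Gh x w)) * \det (H x)).
Proof.
move=> Ux; pose B := lin1_mx (Gh x w).
(* This is metric compatibility in matrix form; both summands contribute tr B to the logarithmic
   derivative. *)
have dH i j : is_derive x w (fun z => H z i j) ((B *m H x + H x *m B^T) i j).
  rewrite (_ : (fun z => _) = (fun z => h z (e i) (e j))); last first.
    by apply/funext => z; rewrite mxE.
  have dh : derivable (fun z => h z (e i) (e j)) x w by exact: smooth_derivable Ux.
  apply: (is_derive_eq (derivableP dh)).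
  rewrite metric // (bilin_suml (bilh Ux) (Gh x w (e i))).
  rewrite (bilin_sumr (bilh Ux) (e i)) !mxE; congr (_ + _).
    by apply: eq_bigr => k _; rewrite !mxE.
  by apply: eq_bigr => k _; rewrite !mxE mulrC.
apply: is_derive_eq (is_derive_det dH) _.
rewrite mulmxDl mxtraceD -!mulmxA mul_mx_adj mul_mx_scalar mxtraceZ.
rewrite mxtrace_mulC -mulmxA mul_adj_mx mul_mx_scalar mxtraceZ mxtrace_tr.
by rewrite -/B; ring.
Qed.

Lemma trace_K x w : U x -> \tr (lin1_mx (K x w)) = 0.
Proof.
move=> Ux.
have -> : lin1_mx (K x w) = lin1_mx (G x w) - lin1_mx (Gh x w).
  by apply/matrixP => i j; rewrite !mxE KE !mxE.
rewrite raddfB /=.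
have <- : \tr (lin1_mx (Gh x w)) = \tr (lin1_mx (G x w)); last exact: subrr.
apply: (log_derivative_sq (is_derive_det_gram w Ux) (is_derive_det_frame w Ux)).
  by apply: filterS (nearU Ux) => z Uz; exact: volume.
exact: det_gram_neq0.
Qed.

Lemma det_gram_congr x X : U x ->
  \det (gram_matrix (h x) X) = \det (\matrix_(i < n) X i) ^+ 2 * \det (H x).
Proof.
move=> Ux; pose M : 'M[R]_n := \matrix_i X i.
have -> : gram_matrix (h x) X = M *m H x *m M^T.
  apply/matrixP => i j; rewrite mxE (bilin_sumr (bilh Ux)) [RHS]mxE.
  apply: eq_bigr => l _; rewrite (bilin_suml (bilh Ux)) [in RHS]mxE.
  rewrite [in RHS]mxE [M j l]mxE [RHS]mulrC; congr (_ * _).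
  by apply: eq_bigr => k _; rewrite !mxE.
by rewrite !det_mulmx det_tr mulrAC.
Qed.

Lemma chart_nilpotent x : U x -> nilpotent_algebra (K x).
Proof.
move=> Ux; apply: jordan_tr0_nilpotent.
- by move=> u v; exact: KC.
- by move=> a u v w; exact: (bilinr (bilK Ux)).
- by move=> a b c w; exact: K_jordan.
- by move=> u; exact: trace_K.
Qed.

(** One sign serves all X, since Gram determinants are the one of the standard basis times a
    square. *)
Lemma chart_det x : U x ->
  (forall X, \det (gram_matrix (h x) X) = 1 * \det (frame X x) ^+ 2) \/
  (forall X, \det (gram_matrix (h x) X) = - 1 * \det (frame X x) ^+ 2).
Proof.
move=> Ux; have [H0|H0] := leP 0 (\det (H x)); [left|right] => X.
  by rewrite mul1r volume // ger0_norm // det_gram_congr // mulr_ge0 // sqr_ge0.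
rewrite mulN1r volume // ler0_norm ?opprK // det_gram_congr //.
by rewrite mulr_ge0_le0 ?sqr_ge0 // ltW.
Qed.

End ChartGeometry.

(** * Reduction to a chart *)

Theorem lemma4p2 (R : realType) (n : nat) (Omega : topologicalType)
    (A : set (chart R n Omega)) (HOmega : smooth_manifold A)
    (f : Omega -> 'rV[R]_(n + 1)) (xi : 'rV[R]_(n + 1))
    (Hf : graph_immersion A f xi)
    (nabla : connection R n Omega) (h : bilinear_field R n Omega)
    (Hind : induced_structure A f (fun _ => xi) nabla h)
    (Hnondeg : nondegenerate_field A h)
    (hatnabla : connection R n Omega) (HLC : levi_civita A h hatnabla)
    (Hparallel : parallel_cubic A hatnabla (cov_bilinear nabla h))
    (y : Omega) (c : chart R n Omega) (Hc : A c) (Hy : chart_dom c y)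
    (Hsphere : improper_affine_hypersphere A f (fun _ => xi)) :
  let J := difference_tensor nabla hatnabla c (chart_map c y) in
  let gamma := h c (chart_map c y) in
  let theta := induced_volume f (fun _ => xi) c (chart_map c y) in
  nilpotent_algebra J /\
  (is_det_wrt theta gamma 1 \/ is_det_wrt theta gamma (- 1)).
Proof.
move=> J gamma theta; set x := chart_map c y.
have Ux : chart_cod c x by exact: chart_map_cod.
case: Hf => -[smooth_f inj_f] trans_f.
case: Hind => connG formh gauss_h.
case: HLC => connGh tfGh metGh.
pose g := f \o chart_inv c.
have volume z X : chart_cod c z ->
    \det (col_mx (\matrix_(i < n) 'D_(X i) g z) xi) ^+ 2 =
    `|\det (gram_matrix (h c z) X)|.
  move=> Uz; have [[_ _ _ [G' [h' [[_ _ gauss_h'] _ vol]]]] _] := Hsphere.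
  (* The affine normal condition brings its own induced structure; uniqueness of the transversal
     component identifies its form with [h]. *)
  have hE : h c z = h' c z.
    apply/funext => u; apply/funext => v.
    have /= e1 := gauss_h c z u v Hc Uz; have /= e2 := gauss_h' c z u v Hc Uz.
    have := frame_inj (smooth_f c Hc) (fun x u => @inj_f c x u Hc)
      (fun x u => @trans_f c x u Hc) Uz (etrans (esym e1) e2).
    by case.
  rewrite hE -[_ ^+ 2]real_normK ?num_real // (vol c z X Hc Uz).
  by rewrite sqr_sqrtr.
have met z w u v : chart_cod c z -> 'D_w (fun t => h c t u v) z =
    h c z (hatnabla c z w u) v + h c z u (hatnabla c z w v).
  move=> Uz; have := metGh c z w u v Hc Uz; rewrite /cov_bilinear.
  by move/eqP; rewrite subr_eq0 subr_eq addrC => /eqP.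
split.
  have openU := @chart_cod_open _ _ _ c.
  apply: (@chart_nilpotent R n (chart_cod c) g xi (nabla c) (hatnabla c) (h c)
    openU (smooth_f c Hc) (fun z u => @inj_f c z u Hc)
    (fun z u => @trans_f c z u Hc)) => //.
  - by move=> z; exact: (connection_bilinear connG).
  - by move=> u v; exact: (connection_smooth connG).
  - by move=> z; exact: (tensor_bilinear formh).
  - by move=> u v; exact: (tensor_smooth formh).
  - by move=> z u v; exact: gauss_h.
  - by move=> z u; exact: Hnondeg.
  - by move=> z; exact: (connection_bilinear connGh).
  - by move=> u v; exact: (connection_smooth connGh).
  - by move=> z u v; exact: tfGh.
  - by move=> z t w u v Uz; exact: Hparallel.
apply: (@chart_det R n (chart_cod c) g xi (h c)) => //.
by move=> z; exact: (tensor_bilinear formh).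
Qed.
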